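(* Let $\mathcal C=(F_v,F_e,\mathcal T)$ be a crystal framework in $\mathbb R^d$ with motif $\mathcal M=(F_v,F_e)$, translation group $\mathcal T$ and period vector matrix $Z$. Then the restriction of the rigidity matrix transformation $R(\mathcal C):\mathcal H_v\to\mathcal H_e$ to the finite-dimensional space $\mathcal H_v^{\rm aff}$ has representing matrix $R(\mathcal M,\mathbb R^{d^2})$. Moreover, the following statements are equivalent: (i) The vector-matrix pair $(u,A)$, with $u\in\mathbb R^{d|F_v|}$ and $A\in M_d(\mathbb R)$, is an affinely periodic infinitesimal flex for $\mathcal C$. (ii) The vector-vector pair $(u,AZ)$ lies in the nullspace of $R(\mathcal M,\mathbb R^{d^2})$. (iii) The vector $\tilde u$ lies in the nullspace of $R(\mathcal C)$, where $\tilde u\in\mathcal H_v$ is the vector defined by the affinely periodic extension formula $\tilde u_{\kappa,k}=u_\kappa-AZk$, $k\in\mathbb Z^d$.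
   Context: A full rank translation group on $\mathbb R^d$ is a set $\mathcal T=\{T_k:k\in\mathbb Z^d\}$ of translations with $T_{k+l}=T_kT_l$ whose period vectors $a_i=T_{\gamma_i}0$ ($\gamma_1,\dots,\gamma_d$ the standard basis of $\mathbb Z^d\subset\mathbb R^d$) are linearly independent. $Z$ is the invertible matrix with $Z\gamma_i=a_i$, so $T_kx=x+Zk$. A crystal framework $\mathcal C=(F_v,F_e,\mathcal T)$ in $\mathbb R^d$ is a countable bar-joint framework (framework points in $\mathbb R^d$ together with framework edges, which are line segments of positive length joining certain pairs of framework points) whose framework points are $p_{\kappa,k}=T_kp_{\kappa,0}$, $1\le\kappa\le t$, $k\in\mathbb Z^d$, such that $F_v=\{p_{\kappa,0}\}$, $F_e$ is a finite set of framework edges, the set of framework points is the disjoint union of the $T_k(F_v)$ and the set of framework edges is the disjoint union of the $T_k(F_e)$. Each $e\in F_e$ is written $e=[p_{\kappa,0},p_{\tau,\delta(e)}]$, with exponent $\delta(e)=(\delta_1,\dots,\delta_d)\in\mathbb Z^d$ and edge vector $v_e=p_{\kappa,0}-p_{\tau,\delta(e)}$; the edge $T_ke=[p_{\kappa,k},p_{\tau,k+\delta(e)}]$ is labelled $(e,k)$. $\mathcal H_v=\prod_{\kappa,k}\mathbb R^d$ and $\mathcal H_e=\prod_{e\in F_e,k\in\mathbb Z^d}\mathbb R$ are direct product vector spaces. The infinite rigidity matrix $R(\mathcal C)$ is the matrix whose row for the edge $(e,k)$ has $v_e$ in the $d$ columns for $(\kappa,k)$, $-v_e$ in the $d$ columns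 for $(\tau,k+\delta(e))$ and zeros elsewhere; it is viewed as a linear map $\mathcal H_v\to\mathcal H_e$. The affinely periodic rigidity matrix $R(\mathcal M,\mathbb R^{d^2})$ is the $|F_e|\times(d|F_v|+d^2)$ real matrix whose row for $e=[p_{\kappa,0},p_{\tau,\delta(e)}]\in F_e$ has $v_e$ in the $d$ columns for $\kappa$, $-v_e$ in the $d$ columns for $\tau$ (if $\kappa=\tau$ the entries in these columns are zero), zeros in the other vertex columns, and $(\delta_1v_e,\dots,\delta_dv_e)$ in the last $d^2$ columns. In a pair $(u,AZ)$, $AZ$ denotes the vector of length $d^2$ given by the $d$ vectors $AZ\gamma_1,\dots,AZ\gamma_d$. $\mathcal H_v^{\rm aff}$ is the subspace of $\mathcal H_v$ of affinely periodic velocity vectors $\tilde v=(\tilde v_{\kappa,k})$, i.e. those of the form $\tilde v_{\kappa,k}=v_\kappa-AZk$ for some $v=(v_\kappa)\in\mathbb R^{d|F_v|}$ and some real $d\times d$ matrix $A$; such $\tilde v$ is said to be determined by $(v,A)$. That the restriction of $R(\mathcal C)$ has representing matrix $R(\mathcal M,\mathbb R^{d^2})$ means that for each $\tilde w\in\mathcal H_v^{\rm aff}$ determined by $(w,B)$ one has $(R(\mathcal C)\tilde w)_{e,k}=(R(\mathcal M,\mathbb R^{d^2})(w,BZ))_e$ for all $e\in F_e$, $k\in\mathbb Z^d$. An affinely periodic infinitesimal flex of $\mathcal C$ is a pair $(u,A)$ with $u\in\mathbb R^{d|F_v|}$ and $A$ a real $d\times d$ matrix such that for all motif edges $e=[p_{\kappa,0},p_{\tau,\delta(e)}]\in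 F_e$, $$\langle p_{\kappa,0}-p_{\tau,\delta(e)},\ u_\kappa-u_\tau+A(p_{\tau,0}-p_{\tau,\delta(e)})\rangle=0.$$
   Formalization: In (i) the pair (u,A) is replaced by (u,−A): with the printed flex condition p_{τ,0}−p_{τ,δ(e)} = −Zδ(e), so (i) for (u,A) has the opposite sign to (ii) and (iii), and the printed equivalence of (i) with (ii) and (iii) is false. *)

(* Defs.v *)
From HB Require Import structures.
From mathcomp Require Import all_boot all_order all_algebra.
From mathcomp Require Import boolp classical_sets functions cardinality fsbigop
  set_interval reals.

Set Implicit Arguments.
Unset Strict Implicit.
Unset Printing Implicit Defensive.

Import Order.TTheory GRing.Theory Num.Theory.
Local Open Scope classical_set_scope.
Local Open Scope ring_scope.

Definition toR (R : realType) (d : nat) (k : 'cV[int]_d) : 'cV[R]_d :=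
  map_mx intr k.

Definition gamma (d : nat) (i : 'I_d) : 'cV[int]_d := delta_mx i 0.

Definition inner (R : realType) (d : nat) (x y : 'cV[R]_d) : R :=
  (x^T *m y) 0 0.

Definition segment (R : realType) (d : nat) (x y : 'cV[R]_d) : set 'cV[R]_d :=
  [set (1 - s) *: x + s *: y | s in `[0, 1]%classic].

Record translation_group (R : realType) (d : nat) := TranslationGroup {
  transl :> 'cV[int]_d -> 'cV[R]_d -> 'cV[R]_d;
  translP : forall k, exists a, forall x, transl k x = x + a;
  translD : forall k l, transl (k + l) = transl k \o transl l;
  transl_free : free [seq transl (gamma i) 0 | i : 'I_d]
}.

Definition period_mx (R : realType) (d : nat) (T : translation_group R d) :
    'M[R]_d :=
  \matrix_(i, j) T (gamma j) 0 i 0.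

(* [F_v] is indexed by ['I_t] and [F_e] by ['I_m]: the edge [e] joins
   [p_(src e),0] to [p_(tgt e),(expo e)].  Injectivity of
   [(kappa, k) |-> T_k p_kappa] and of [(e, k) |-> T_k e] expresses both that
   the indexings are without repetition and that the points (resp. edges) of
   the framework are the disjoint union of the translates of F_v (resp. F_e). *)
Record crystal_framework (R : realType) (d : nat) := CrystalFramework {
  tgroup : translation_group R d;
  nvert : nat;
  nedge : nat;
  vert : 'I_nvert -> 'cV[R]_d;
  src : 'I_nedge -> 'I_nvert;
  tgt : 'I_nedge -> 'I_nvert;
  expo : 'I_nedge -> 'cV[int]_d;
  vert_inj : injective (fun x : 'I_nvert * 'cV[int]_d =>
    tgroup x.2 (vert x.1));
  edge_pos : forall e, vert (src e) != tgroup (expo e) (vert (tgt e));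
  edge_inj : injective (fun x : 'I_nedge * 'cV[int]_d =>
    tgroup x.2 @` segment (vert (src x.1))
                          (tgroup (expo x.1) (vert (tgt x.1))))
}.

Section Rigidity.
Variables (R : realType) (d : nat) (C : crystal_framework R d).

Local Notation Z := (period_mx (tgroup C)).

Definition joint (kappa : 'I_(nvert C)) (k : 'cV[int]_d) : 'cV[R]_d :=
  tgroup C k (vert kappa).

Definition edge_vec (e : 'I_(nedge C)) : 'cV[R]_d :=
  joint (src e) 0 - joint (tgt e) (expo e).

Definition Hv := 'I_(nvert C) * 'cV[int]_d -> 'cV[R]_d.
Definition He := 'I_(nedge C) * 'cV[int]_d -> R.

(* The 1 x d block of R(C) in row (e, k) and the d columns of (kappa, l). *)
Definition rigidity_block (ek : 'I_(nedge C) * 'cV[int]_d)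
    (x : 'I_(nvert C) * 'cV[int]_d) : 'rV[R]_d :=
  if x == (src ek.1, ek.2) then (edge_vec ek.1)^T
  else if x == (tgt ek.1, ek.2 + expo ek.1) then - (edge_vec ek.1)^T
  else 0.

Definition rigidity_map (w : Hv) : He :=
  fun ek => \sum_(x \in [set: 'I_(nvert C) * 'cV[int]_d])
    (rigidity_block ek x *m w x) 0 0.

(* The two vertex terms add up, so that they cancel when [src e = tgt e]. *)
Definition affine_rigidity_mx :
    'M[R]_(nedge C, nvert C * d + d * d) :=
  \matrix_(e < nedge C)
    row_mx
      (mxvec (\matrix_(kappa < nvert C)
        ((kappa == src e)%:R *: (edge_vec e)^T
         - (kappa == tgt e)%:R *: (edge_vec e)^T)))
      (mxvec (\matrix_(i < d) (toR R (expo e) i 0 *: (edge_vec e)^T))).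

(* The column vector (u, B), where B stands for the list of its columns
   B gamma_1, ..., B gamma_d. *)
Definition vec_pair (u : 'I_(nvert C) -> 'cV[R]_d) (B : 'M[R]_d) :
    'cV[R]_(nvert C * d + d * d) :=
  (row_mx (mxvec (\matrix_(kappa < nvert C) (u kappa)^T)) (mxvec B^T))^T.

Definition affine_extension (u : 'I_(nvert C) -> 'cV[R]_d) (A : 'M[R]_d) : Hv :=
  fun x => u x.1 - A *m Z *m toR R x.2.

Definition Hv_aff : set Hv :=
  [set w | exists u A, w = affine_extension u A].

Definition represents_on_aff (f : Hv -> He)
    (M : 'M[R]_(nedge C, nvert C * d + d * d)) : Prop :=
  forall wt, Hv_aff wt -> forall w B, wt = affine_extension w B ->
  forall e k, f wt (e, k) = (M *m vec_pair w (B *m Z)) e 0.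

(* Since [joint tau k = vert tau + Z k], the second factor below equals
   [u_kappa - u_tau - A Z delta], the difference along the edge of the velocity
   [u_kappa + A Z k].  [affine_extension] and the last d^2 columns of
   [affine_rigidity_mx] use the opposite sign, so a flex [(u, A)] corresponds to
   [affine_extension u (- A)] and to [vec_pair u (- A *m Z)]. *)
Definition affine_flex (u : 'I_(nvert C) -> 'cV[R]_d) (A : 'M[R]_d) : Prop :=
  forall e, inner (joint (src e) 0 - joint (tgt e) (expo e))
    (u (src e) - u (tgt e)
     + A *m (joint (tgt e) 0 - joint (tgt e) (expo e))) = 0.

End Rigidity.

(* Main.v *)
Require Import Defs.
From HB Require Import structures.
From mathcomp Require Import all_boot all_order all_algebra.
From mathcomp Require Import boolp classical_sets functions cardinality fsbigop
  set_interval reals.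
Import Order.TTheory GRing.Theory Num.Theory.
Local Open Scope ring_scope.

(** Both rigidity matrices compute, for each edge, half the rate of change of
its squared length under the given velocities.  Row [(e, k)] of the infinite
matrix has only two nonzero blocks, so [rigidity_map w (e, k)] is the inner
product of [edge_vec e] with the difference of the velocities of the two ends
of the edge [(e, k)] ([rigidity_mapE]).  For an affinely periodic velocity
[u_kappa - A Z k] this difference is [u_src - u_tgt + A Z delta(e)]: the
dependence on [k] cancels, since the two ends lie in cells that differ by
[delta(e)].  The inner product of [edge_vec e] with this same vector is row
[e] of the finite matrix applied to [(u, A Z)]
([affine_rigidity_mx_vec_pairE]), whose last [d^2] columns, the blocks
[delta_i edge_vec e], recombine the columns of [A Z] into [A Z delta(e)].
This is the representation statement, and it makes the two nullspace
conditions agree row by row.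

The flex condition involves instead the vector
[p_(tgt e, 0) - p_(tgt e, delta(e))].  A homomorphism from Z^d to the
translations is determined by the period vectors, so
[T_k x = x + Z k] ([translE]) and this vector is [- Z delta(e)], which turns
the flex condition for [- A] into the same inner product. *)

Lemma innerDr {R : realType} {d : nat} (x y z : 'cV[R]_d) :
  inner x (y + z) = inner x y + inner x z.
Proof. by rewrite /inner mulmxDr mxE. Qed.

Lemma innerNr {R : realType} {d : nat} (x y : 'cV[R]_d) :
  inner x (- y) = - inner x y.
Proof. by rewrite /inner mulmxN mxE. Qed.

Lemma innerC {R : realType} {d : nat} (x y : 'cV[R]_d) : inner x y = inner y x.
Proof. by rewrite /inner -[x^T *m y]trmxK trmx_mul trmxK mxE. Qed.

Lemma toRD {R : realType} {d : nat} (k l : 'cV[int]_d) :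
  toR R (k + l) = toR R k + toR R l.
Proof. exact: map_mxD. Qed.

Lemma cV_eq0 {R : realType} {n : nat} (x : 'cV[R]_n) :
  (forall i, x i 0 = 0) <-> x = 0.
Proof.
split=> [x0|-> i]; last by rewrite mxE.
by apply/colP => i; rewrite x0 mxE.
Qed.

Lemma cV_sum_gamma {d : nat} (k : 'cV[int]_d) :
  k = \sum_(i < d) gamma i *~ k i 0.
Proof.
rewrite [LHS]matrix_sum_delta; apply: eq_bigr => i _.
by rewrite big_ord1 -scaler_int intz.
Qed.

Section Translations.
Context {R : realType} {d : nat} (T : translation_group R d).

Lemma transl_origin (k : 'cV[int]_d) (x : 'cV[R]_d) : T k x = x + T k 0.
Proof. by have [a Ta] := translP T k; rewrite !Ta add0r. Qed.

Definition shift (k : 'cV[int]_d) : 'cV[R]_d := T k 0.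

Lemma shiftD : {morph shift : k l / k + l}.
Proof.
by move=> k l; rewrite /shift translD /= transl_origin addrC.
Qed.

Lemma shiftB : {morph shift : k l / k - l}.
Proof. by move=> k l; apply: (addIr (shift l)); rewrite -shiftD !subrK. Qed.

HB.instance Definition _ :=
  GRing.isZmodMorphism.Build 'cV[int]_d 'cV[R]_d shift shiftB.

(** A homomorphism out of Z^d is determined by its values on the standard
basis, and those of [shift] are the columns of the period matrix. *)
Lemma shiftE (k : 'cV[int]_d) : shift k = period_mx T *m toR R k.
Proof.
rewrite {1}[k]cV_sum_gamma raddf_sum /=; apply/colP => i.
rewrite summxE mxE; apply: eq_bigr => j _.
by rewrite raddfMz /= -scaler_int !mxE mulrC.
Qed.

Lemma translE (k : 'cV[int]_d) (x : 'cV[R]_d) :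
  T k x = x + period_mx T *m toR R k.
Proof. by rewrite transl_origin -shiftE. Qed.

End Translations.

Section Rigidity.
Context {R : realType} {d : nat} (C : crystal_framework R d).

Local Notation Z := (period_mx (tgroup C)).

Lemma joint0_subE (kappa : 'I_(nvert C)) (k : 'cV[int]_d) :
  joint kappa 0 - joint kappa k = - (Z *m toR R k).
Proof. by rewrite /joint !translE /toR map_mx0 mulmx0 addr0 opprD addNKr. Qed.

(** An edge has positive length, so its ends carry different labels; the two
branches of [rigidity_block] then never compete for the same column. *)
Lemma edge_ends_neq (e : 'I_(nedge C)) (k : 'cV[int]_d) :
  (src e, k) != (tgt e, k + expo e).
Proof.
apply/eqP => -[est k_ex].
have ex0 : expo e = 0 by apply: (addrI k); rewrite -k_ex addr0.
by move: (edge_pos e); rewrite est ex0 translE /toR map_mx0 mulmx0 addr0 eqxx.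
Qed.

Lemma rigidity_mapE (w : Hv C) (e : 'I_(nedge C)) (k : 'cV[int]_d) :
  rigidity_map w (e, k)
    = inner (edge_vec e) (w (src e, k) - w (tgt e, k + expo e)).
Proof.
have nend := edge_ends_neq e k.
rewrite /rigidity_map.
rewrite -(@fsbig_widen _ _ _ _ [set` [:: (src e, k); (tgt e, k + expo e)]]) //.
  rewrite -fsbig_seq /= ?inE ?nend // big_cons big_seq1 /rigidity_block /=.
  rewrite eqxx (negPf (_ : _ != (src e, k))) 1?eq_sym // eqxx.
  by rewrite innerDr innerNr mulNmx [in X in _ + X]mxE.
move=> x [_ /=]; rewrite !inE => /negP; rewrite negb_or => /andP[ns nt].
by rewrite /rigidity_block /= (negPf ns) (negPf nt) mul0mx mxE.
Qed.

(** Both blocks of row [e] are flattened products of a column and the row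
[(edge_vec e)^T], so each contributes a bilinear form evaluated at
[edge_vec e] ([mxvec_dotmul]).  For the vertex block the column is the
difference of the unit vectors at the two ends. *)
Lemma affine_rigidity_mx_vec_pairE (u : 'I_(nvert C) -> 'cV[R]_d)
    (B : 'M[R]_d) (e : 'I_(nedge C)) :
  (affine_rigidity_mx C *m vec_pair u B) e 0
    = inner (edge_vec e) (u (src e) - u (tgt e) + B *m toR R (expo e)).
Proof.
set v := edge_vec e.
have vert_block : \matrix_(kappa < nvert C)
    ((kappa == src e)%:R *: v^T - (kappa == tgt e)%:R *: v^T)
  = (delta_mx 0 (src e) - delta_mx 0 (tgt e))^T *m v^T.
  apply/matrixP => i j; rewrite !mxE big_ord1 !mxE.
  by rewrite mulrBl.
have period_block : \matrix_(i < d) (toR R (expo e) i 0 *: v^T)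
  = ((toR R (expo e))^T)^T *m v^T.
  by apply/matrixP => i j; rewrite !mxE big_ord1 !mxE.
transitivity ((row e (affine_rigidity_mx C) *m vec_pair u B) 0 0).
  by rewrite -row_mul [RHS]mxE.
rewrite rowK vert_block period_block /vec_pair tr_row_mx mul_row_col.
rewrite !mxvec_dotmul trmxK -mulmxDl innerC /inner mulmxBl -!rowE !rowK.
by rewrite -trmx_mul -linearB -linearD.
Qed.

Lemma rigidity_map_affine_extension (u : 'I_(nvert C) -> 'cV[R]_d)
    (A : 'M[R]_d) (e : 'I_(nedge C)) (k : 'cV[int]_d) :
  rigidity_map (affine_extension u A) (e, k)
    = (affine_rigidity_mx C *m vec_pair u (A *m Z)) e 0.
Proof.
rewrite rigidity_mapE affine_rigidity_mx_vec_pairE /affine_extension /= toRD.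
congr (inner _ _); rewrite mulmxDr opprB -[X in _ + X]addrA [LHS]addrA subrK.
by rewrite addrCA addrC.
Qed.

Lemma affine_flexE (u : 'I_(nvert C) -> 'cV[R]_d) (A : 'M[R]_d) :
  affine_flex u (- A) <->
  forall e, (affine_rigidity_mx C *m vec_pair u (A *m Z)) e 0 = 0.
Proof.
by split=> flex e; move: (flex e);
  rewrite affine_rigidity_mx_vec_pairE joint0_subE mulmxN mulNmx opprK mulmxA.
Qed.

End Rigidity.

Theorem theorem2p7 (R : realType) (d : nat) (C : crystal_framework R d) :
  represents_on_aff (@rigidity_map R d C) (affine_rigidity_mx C) /\
  forall (u : 'I_(nvert C) -> 'cV[R]_d) (A : 'M[R]_d),
    (affine_flex u (- A) <->
       affine_rigidity_mx C *m vec_pair u (A *m period_mx (tgroup C)) = 0) /\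
    (affine_rigidity_mx C *m vec_pair u (A *m period_mx (tgroup C)) = 0 <->
       rigidity_map (affine_extension u A) = 0 :> ('I_(nedge C) * 'cV[int]_d -> R)).
Proof.
split=> [_ _ w B -> e k|u A]; first exact: rigidity_map_affine_extension.
split; first by rewrite affine_flexE -cV_eq0.
rewrite -cV_eq0; split=> [null|null e].
  by apply/funext => -[e k]; rewrite rigidity_map_affine_extension null.
by rewrite -(rigidity_map_affine_extension C u A e 0) null.
Qed.
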